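(* Let $K$ be a field, $n\ge2$, $\Lambda=K\langle x_1,\dots,x_n\rangle$, viewed as a subalgebra of the Leavitt algebra $\mathbb{L}$. Let $\gamma$ and $\delta$ be comonic polynomials in $\Lambda$. Then there is a comonic polynomial $\lambda\in\Lambda$ such that $\mathbb{L}\delta+\mathbb{L}\gamma=\mathbb{L}\lambda$.
   Context: $\mathbb{L}=\mathbb{L}_K(1,n)$ is the unital $K$-algebra generated by $x_1,\dots,x_n,x_1^*,\dots,x_n^*$ subject to $\sum_{i=1}^n x_ix_i^*=1$, $x_j^*x_i=1$ if $i=j$ and $x_j^*x_i=0$ if $i\ne j$. The subalgebra generated by $x_1,\dots,x_n$ is the free algebra $\Lambda$. A polynomial in $\Lambda$ is comonic if its constant term is $1$. *)

(* Defs.v *)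
From HB Require Import structures.
From mathcomp Require Import all_boot all_algebra.
From mathcomp Require Import finmap boolp classical_sets.
From mathcomp.multinomials Require Import monalg.

Set Implicit Arguments.
Unset Strict Implicit.
Unset Printing Implicit Defensive.

Import GRing.Theory.


Local Open Scope ring_scope.
Local Open Scope quotient_scope.
Local Open Scope classical_set_scope.

(* The library only puts a ring structure on quotients of commutative rings,
   so the quotient of a ring by the two-sided ideal generated by a set is
   built here on top of the library's quotient of additive groups. *)
Inductive in_ideal (A : pzRingType) (S : set A) : A -> Prop :=
  | in_ideal_gen s : S s -> in_ideal S s
  | in_ideal0 : in_ideal S 0
  | in_idealB u v : in_ideal S u -> in_ideal S v -> in_ideal S (u - v)
  | in_idealMl a u : in_ideal S u -> in_ideal S (a * u)
  | in_idealMr a u : in_ideal S u -> in_ideal S (u * a).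

Definition ideal_gen (A : pzRingType) (S : set A) : {pred A} :=
  fun u => `[< in_ideal S u >].

Section RingQuotient.
Variables (A : pzRingType) (S : set A).

Lemma ideal_genP u : reflect (in_ideal S u) (u \in ideal_gen S).
Proof. exact: asboolP. Qed.

Lemma ideal_gen_zmod_closed : zmod_closed (ideal_gen S).
Proof.
split=> [|u v /ideal_genP uI /ideal_genP vI]; apply/ideal_genP.
  exact: in_ideal0.
exact: in_idealB.
Qed.

HB.instance Definition _ :=
  GRing.isZmodClosed.Build A (ideal_gen S) ideal_gen_zmod_closed.

Definition ring_quot : Type := Quotient.quot (ideal_gen S).

HB.instance Definition _ := GRing.Zmodule.on ring_quot.

Definition quot_pi (u : A) : ring_quot := \pi_(Quotient.quot (ideal_gen S)) u.

Definition quot_mul (x y : ring_quot) : ring_quot :=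
  quot_pi (repr x * repr y).

Lemma quot_piP (x : ring_quot) : exists u, x = quot_pi u.
Proof. by exists (repr x); rewrite /quot_pi reprK. Qed.

Lemma quot_pi_eq u v : quot_pi u = quot_pi v <-> in_ideal S (u - v).
Proof.
rewrite (rwP (ideal_genP _)) Quotient.idealrBE.
by split=> /eqP.
Qed.

Lemma quot_piB : {morph quot_pi : u v / u - v}.
Proof. by move=> u v; rewrite /quot_pi !piE. Qed.

Lemma quot_piD : {morph quot_pi : u v / u + v}.
Proof. by move=> u v; rewrite /quot_pi !piE. Qed.

Lemma quot_piM u v : quot_mul (quot_pi u) (quot_pi v) = quot_pi (u * v).
Proof.
apply/quot_pi_eq.
set u' := repr _; set v' := repr _.
have uI : in_ideal S (u' - u) by apply/quot_pi_eq; rewrite /quot_pi reprK.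
have vI : in_ideal S (v' - v) by apply/quot_pi_eq; rewrite /quot_pi reprK.
have -> : u' * v' - u * v = (u' - u) * v' - (- u) * (v' - v).
  by rewrite mulrBl mulNr opprK mulrBr addrA subrK.
by apply: in_idealB; [apply: in_idealMr | apply: in_idealMl].
Qed.

Lemma quot_mulA : associative quot_mul.
Proof.
move=> x y z; have [u ->] := quot_piP x; have [v ->] := quot_piP y.
by have [w ->] := quot_piP z; rewrite !quot_piM mulrA.
Qed.

Lemma quot_mul1 : left_id (quot_pi 1) quot_mul.
Proof. by move=> x; have [u ->] := quot_piP x; rewrite quot_piM mul1r. Qed.

Lemma quot_mulr1 : right_id (quot_pi 1) quot_mul.
Proof. by move=> x; have [u ->] := quot_piP x; rewrite quot_piM mulr1. Qed.

Lemma quot_mulDl : left_distributive quot_mul +%R.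
Proof.
move=> x y z; have [u ->] := quot_piP x; have [v ->] := quot_piP y.
by have [w ->] := quot_piP z; rewrite -quot_piD !quot_piM mulrDl quot_piD.
Qed.

Lemma quot_mulDr : right_distributive quot_mul +%R.
Proof.
move=> x y z; have [u ->] := quot_piP x; have [v ->] := quot_piP y.
by have [w ->] := quot_piP z; rewrite -quot_piD !quot_piM mulrDr quot_piD.
Qed.

HB.instance Definition _ := GRing.Zmodule_isPzRing.Build ring_quot
  quot_mulA quot_mul1 quot_mulr1 quot_mulDl quot_mulDr.

Lemma quot_pi_monoid_morphism : monoid_morphism quot_pi.
Proof. by split=> // u v; rewrite -quot_piM. Qed.

HB.instance Definition _ := GRing.isZmodMorphism.Build A ring_quot quot_pi
  quot_piB.
HB.instance Definition _ := GRing.isMonoidMorphism.Build A ring_quot quot_pi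
  quot_pi_monoid_morphism.

End RingQuotient.

(* Noncommutative polynomials: the monoid algebra of the free monoid of words. *)
Notation free_alg K I := {malg K[{fmonom I}]}.

Definition free_var (K : fieldType) (I : choiceType) (i : I) : free_alg K I :=
  << fmu i >>.

Definition comonic (K : fieldType) (I : choiceType) (p : free_alg K I) : Prop :=
  p@_mone = 1.

Section Leavitt.
Variables (K : fieldType) (n : nat).

(* The letters [inl i] and [inr i] stand for x_i and x_i^*. *)
Local Notation F := (free_alg K ('I_n + 'I_n)%type).
Let X (i : 'I_n) : F := free_var K (inl i).
Let Y (i : 'I_n) : F := free_var K (inr i).

Definition leavitt_rel : set F :=
  [set r | r = \sum_i X i * Y i - 1 \/
           exists i j, r = Y j * X i - (i == j)%:R].

Definition leavitt : Type := ring_quot leavitt_rel.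

HB.instance Definition _ := GRing.PzRing.on leavitt.

Definition leavitt_pi : F -> leavitt := @quot_pi F leavitt_rel.

HB.instance Definition _ := GRing.RMorphism.on leavitt_pi.

Definition lx (i : 'I_n) : leavitt := leavitt_pi (X i).
Definition lxs (i : 'I_n) : leavitt := leavitt_pi (Y i).

(* MathComp's algebra structures require 1 != 0, which fails for n = 0, so
   [leavitt] is only registered as a ring and as a K-module. *)
Definition leavitt_scale (c : K) (u : leavitt) : leavitt :=
  leavitt_pi c%:MP * u.

Lemma leavitt_scaleA c d u :
  leavitt_scale c (leavitt_scale d u) = leavitt_scale (c * d) u.
Proof. by rewrite /leavitt_scale !rmorphM mulrA. Qed.

Lemma leavitt_scale1 : left_id 1 leavitt_scale.
Proof. by move=> u; rewrite /leavitt_scale !rmorph1 mul1r. Qed.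

Lemma leavitt_scaleDr : right_distributive leavitt_scale +%R.
Proof. by move=> c u v; rewrite /leavitt_scale mulrDr. Qed.

Lemma leavitt_scaleDl u : {morph leavitt_scale^~ u : c d / c + d}.
Proof. by move=> c d; rewrite /leavitt_scale !rmorphD mulrDl. Qed.

HB.instance Definition _ := GRing.Zmodule_isLmodule.Build K leavitt
  leavitt_scaleA leavitt_scale1 leavitt_scaleDr leavitt_scaleDl.

Lemma leavitt_scalerAl (c : K) (u v : leavitt) : c *: (u * v) = (c *: u) * v.
Proof. exact: mulrA. Qed.

Lemma leavitt_scalerAr (c : K) (u v : leavitt) : c *: (u * v) = u * (c *: v).
Proof.
rewrite /GRing.scale /= /leavitt_scale; have [f ->] := quot_piP u.
rewrite -/(leavitt_pi f) !mulrA -!rmorphM; congr (leavitt_pi _ * v).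
rewrite -[RHS]/(fgmul f c%:MP) fgmulgU mul_malgC malgZ_def.
by apply: eq_bigr => m _; rewrite mulrC mulm1.
Qed.

Lemma sum_lx_lxs : \sum_i lx i * lxs i = 1.
Proof.
rewrite -(rmorph1 leavitt_pi); under eq_bigr do rewrite -rmorphM.
by rewrite -rmorph_sum; apply/quot_pi_eq/in_ideal_gen; left.
Qed.

Lemma lxs_lx i j : lxs j * lx i = (i == j)%:R.
Proof.
rewrite -(rmorph_nat leavitt_pi) -rmorphM.
by apply/quot_pi_eq/in_ideal_gen; right; exists i, j.
Qed.

(* The inclusion of the free algebra on x_1, ..., x_n in [leavitt]. *)
Definition leavitt_of_free (p : free_alg K 'I_n) : leavitt :=
  \sum_(m <- msupp p) p@_m *: \prod_(i <- m) lx i.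

End Leavitt.

Definition left_ideal (A : pzRingType) (a : A) : set A := range (fun r => r * a).

Definition add_ideal (A : pzRingType) (I J : set A) : set A :=
  [set u + v | u in I & v in J].

(* Main.v *)
Require Import Defs.
From HB Require Import structures.
From mathcomp Require Import all_boot all_algebra.
From mathcomp Require Import finmap boolp classical_sets.
From mathcomp.multinomials Require Import monalg.

(** Let [I] be a left ideal of the Leavitt algebra containing a comonic
    polynomial, and let [lambda] be a comonic polynomial in [I] of least degree.
    For a polynomial [p] in [I] with constant term [c], the difference
    [p - c lambda] has constant term zero, hence equals [\sum_i x_i q_i] where
    [q_i = x_i^* (p - c lambda)] again lies in [I].  If [c] is nonzero then
    [c^-1 p] is comonic, so [deg lambda <= deg p] by minimality; in all cases
    the [q_i] have smaller degree than [p].  By induction on the degree, every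
    polynomial in [I] lies in [L lambda]. *)

Import GRing.Theory.
Local Open Scope fset_scope.
Local Open Scope ring_scope.

Section FreeAlgebra.
Context {K : fieldType} {I : choiceType}.
Implicit Types (p q : free_alg K I) (d : nat).

(* One more than the degree, and 0 for the zero polynomial. *)
Definition free_size p : nat := mmeasure (@fdeg I) p.

Lemma free_size_le_msupp d p :
  (forall m : {fmonom I}, m \in msupp p -> (size m < d)%N) ->
  (free_size p <= d)%N.
Proof.
move=> p_d; rewrite /free_size mmeasureE big_seq.
by apply: (big_ind (fun k => k <= d)%N) => // k l; rewrite geq_max => -> ->.
Qed.

Lemma free_sizeZ_le c p : (free_size (c *: p) <= free_size p)%N.
Proof.
apply: free_size_le_msupp => m /(fsubsetP (msuppZ_le c p)).
exact: mmeasure_mnm_lt.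
Qed.

Lemma free_sizeB_le d p q :
  (free_size p <= d)%N -> (free_size q <= d)%N -> (free_size (p - q) <= d)%N.
Proof.
move=> p_d q_d; apply: leq_trans (mmeasureD_le _ _ _) _.
by rewrite mmeasureN geq_max p_d q_d.
Qed.

(* The [q_i] in the decomposition [p = p_0 + \sum_i x_i q_i]. *)
Definition free_lquo (i : I) p : free_alg K I :=
  \sum_(m <- msupp p | ohead m == Some i) << p@_m *g FMonom (behead m) >>.

(** Words of the quotient are words of [p] without their first letter. For [d = 0] this says that
    the quotient of a constant is zero. *)
Lemma free_size_lquo i d p :
  (free_size p <= d.+1)%N -> (free_size (free_lquo i p) <= d)%N.
Proof.
move=> p_d; rewrite /free_size /free_lquo.
apply: leq_trans (mmeasure_sum _ _ _ _) _.
rewrite big_seq_cond; apply: (big_ind (fun k => k <= d)%N) => //.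
  by move=> k l; rewrite geq_max => -> ->.
move=> [[|j s]] /andP[ps] //= _; apply: free_size_le_msupp => m.
move=> /(fsubsetP msuppU_le); rewrite inE => /eqP -> /=.
rewrite -ltnS; apply: leq_trans _ p_d.
exact: (mmeasure_mnm_lt (@fdeg I) ps).
Qed.

End FreeAlgebra.

Section Evaluation.
Context {K : fieldType} {n : nat}.
Implicit Types p q : free_alg K 'I_n.
Local Notation phi := (@leavitt_of_free K n).
Local Notation word s := (\prod_(i <- s) lx K i).

(** Words outside the support have coefficient zero, so several polynomials can be summed over one
    common set of words. *)
Lemma leavitt_of_free_widen (D : {fset {fmonom 'I_n}}) p :
  msupp p `<=` D -> phi p = \sum_(m <- D) p@_m *: word m.
Proof.
move=> pD; rewrite /leavitt_of_free (big_fset_incl _ pD) // => m _.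
by move/mcoeff_outdom->; rewrite scale0r.
Qed.

Lemma leavitt_of_free_is_linear : linear phi.
Proof.
move=> c p q; pose D := msupp p `|` msupp q.
have pD : msupp p `<=` D by apply: fsubsetUl.
have qD : msupp q `<=` D by apply: fsubsetUr.
have cpqD : msupp (c *: p + q) `<=` D.
  apply: fsubset_trans (msuppD_le _ _) _; rewrite fsubUset qD andbT.
  exact: fsubset_trans (msuppZ_le _ _) pD.
rewrite !(@leavitt_of_free_widen D) // scaler_sumr -big_split /=.
by apply: eq_bigr => m _; rewrite mcoeffD mcoeffZ scalerDl scalerA.
Qed.

HB.instance Definition _ := GRing.isLinear.Build K (free_alg K 'I_n)
  (leavitt K n) _ phi leavitt_of_free_is_linear.

(** Turns scaling into left multiplication, under which left ideals are closed. *)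
Lemma leavitt_of_freeZ c p : phi (c *: p) = leavitt_pi c%:MP * phi p.
Proof. exact: linearZ. Qed.

Lemma leavitt_of_freeU c m : phi << c *g m >> = c *: word m.
Proof.
by rewrite (leavitt_of_free_widen _ _ msuppU_le) big_seq_fset1 mcoeffUU.
Qed.

(** The nonempty words of [p] are grouped by their first letter. *)
Lemma leavitt_of_free_lquo p :
  p@_mone = 0 -> phi p = \sum_i lx K i * phi (free_lquo i p).
Proof.
move=> p0; under eq_bigr => i _.
  rewrite raddf_sum mulr_sumr big_mkcond /=; over.
(* The inner sum now runs over the letters: the empty word contributes nothing, and the word
   [j :: s] only at the letter [j]. *)
rewrite exchange_big /=; apply: eq_bigr => -[[|j s]] _ /=.
  have -> : FMonom [::] = mone :> {fmonom 'I_n} by rewrite -fmoneE.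
  by rewrite p0 scale0r big1.
rewrite (bigD1 j) //= eqxx [X in (_ + X)%R]big1 => [|i /negPf ij].
  by rewrite addr0 leavitt_of_freeU big_cons -leavitt_scalerAr.
by case: eqP => // -[ji]; rewrite ji eqxx in ij.
Qed.

(** The relations [x_i^* x_j = delta_ij] select one summand of the decomposition. Hence a left ideal
    containing [phi p] contains the images of all the quotients. *)
Lemma lxs_leavitt_of_free i p :
  p@_mone = 0 -> lxs K i * phi p = phi (free_lquo i p).
Proof.
move=> p0; rewrite (leavitt_of_free_lquo _ p0) mulr_sumr (bigD1 i) //=.
rewrite big1 => [|j /negPf ji]; rewrite mulrA lxs_lx; last by rewrite ji mul0r.
by rewrite eqxx mul1r addr0.
Qed.

End Evaluation.

Section LeftIdeals.
Context {A : pzRingType}.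
Implicit Types (a b : A) (J : set A).

Definition lideal_closed J :=
  [/\ J 0, forall u v, J u -> J v -> J (u + v) & forall a u, J u -> J (a * u)].

Lemma left_ideal_refl a : left_ideal a a.
Proof. by exists 1; rewrite ?mul1r. Qed.

Lemma left_ideal_closed a : lideal_closed (left_ideal a).
Proof.
split=> [|_ _ [r _ <-] [s _ <-]|r _ [s _ <-]].
- by exists 0; rewrite ?mul0r.
- by exists (r + s); rewrite ?mulrDl.
- by exists (r * s); rewrite ?mulrA.
Qed.

Lemma add_ideal_closed J1 J2 :
  lideal_closed J1 -> lideal_closed J2 -> lideal_closed (add_ideal J1 J2).
Proof.
move=> [J10 J1D J1M] [J20 J2D J2M]; split.
- by exists 0 => //; exists 0; rewrite ?addr0.
- move=> _ _ [u1 uJ1 [u2 uJ2 <-]] [v1 vJ1 [v2 vJ2 <-]].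
  exists (u1 + v1); first exact: J1D.
  by exists (u2 + v2); [exact: J2D | rewrite addrACA].
- move=> a _ [u1 uJ1 [u2 uJ2 <-]].
  exists (a * u1); first exact: J1M.
  by exists (a * u2); [exact: J2M | rewrite mulrDr].
Qed.

Lemma left_ideal_sub a J :
  lideal_closed J -> J a -> (left_ideal a `<=` J)%classic.
Proof. by move=> [_ _ JM] Ja _ [r _ <-]; apply: JM. Qed.

Lemma lideal_sum J (T : Type) (s : seq T) (F : T -> A) :
  lideal_closed J -> (forall i, J (F i)) -> J (\sum_(i <- s) F i).
Proof. by move=> [J0 JD _] JF; apply: big_ind. Qed.

End LeftIdeals.

(** Controlling the polynomials in [J] suffices later, where [J] is generated by polynomials. *)
Lemma lideal_comonic_generator (K : fieldType) (n : nat)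
    (J : set (leavitt K n)) (gamma : free_alg K 'I_n) :
  lideal_closed J -> comonic gamma -> J (leavitt_of_free gamma) ->
  exists lambda, [/\ comonic lambda, J (leavitt_of_free lambda) &
    forall p, J (leavitt_of_free p) ->
      left_ideal (leavitt_of_free lambda) (leavitt_of_free p)].
Proof.
move=> Jcl gamma1 Jgamma; have [_ JD JM] := Jcl.
(* The sizes attained by comonic polynomials in [J]; [gamma] shows that there is one, so a least one
   exists. *)
pose comonic_size d := `[< exists q : free_alg K 'I_n,
  [/\ comonic q, J (leavitt_of_free q) & free_size q = d] >].
have exd : exists d, comonic_size d.
  by exists (free_size gamma); apply/asboolP; exists gamma.
case: (ex_minnP exd) => _ /asboolP[lambda [lambda1 Jlambda <-]] lambda_min.
exists lambda; split=> // p; have [d] := ubnPleq (free_size p).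
have Lcl := left_ideal_closed (leavitt_of_free lambda).
(* Induction on a bound for the size; size 0 forces [p = 0]. *)
elim: d p => [|d IHd] p p_d Jp.
  move: p_d; rewrite leqn0 mmeasure_eq0 => /eqP ->.
  by rewrite raddf0; case: Lcl.
pose c := p@_mone; pose r := p - c *: lambda.
have r0 : r@_mone = 0 by rewrite mcoeffB mcoeffZ lambda1 mulr1 subrr.
have r_d : (free_size r <= d.+1)%N.
  apply: free_sizeB_le => //; have [->|c0] := eqVneq c 0.
    by rewrite scale0r /free_size mmeasure0.
  (* Scaling never raises the size, so it remains to compare [lambda] with the comonic polynomial
     [c^-1 *: p]. *)
  apply: leq_trans (free_sizeZ_le _ _) _.
  apply: leq_trans (leq_trans (free_sizeZ_le c^-1 p) p_d).
  apply: lambda_min; apply/asboolP; exists (c^-1 *: p); split.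
  - by rewrite /comonic mcoeffZ mulVf.
  - by rewrite leavitt_of_freeZ; apply: JM.
  - by [].
have Jr : J (leavitt_of_free r).
  rewrite /r -scaleNr raddfD /= leavitt_of_freeZ.
  by apply: JD => //; apply: JM.
have -> : p = r + c *: lambda by rewrite subrK.
have [_ LD LM] := Lcl; rewrite raddfD /= leavitt_of_freeZ.
apply: (LD); last by eexists.
rewrite (leavitt_of_free_lquo _ r0); apply: (lideal_sum _ _ _ _ Lcl) => i.
apply: LM; apply: IHd; first exact: free_size_lquo.
by rewrite -(lxs_leavitt_of_free _ _ r0); apply: JM.
Qed.

Theorem theorem4p9 (K : fieldType) (n : nat) (hn : (2 <= n)%N)
    (gamma delta : free_alg K 'I_n)
    (gamma_comonic : comonic gamma) (delta_comonic : comonic delta) :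
  exists lambda : free_alg K 'I_n,
    comonic lambda /\
    add_ideal (left_ideal (leavitt_of_free delta))
              (left_ideal (leavitt_of_free gamma)) =
    left_ideal (leavitt_of_free lambda).
Proof.
have dcl := left_ideal_closed (leavitt_of_free delta).
have gcl := left_ideal_closed (leavitt_of_free gamma).
have Jcl := add_ideal_closed _ _ dcl gcl.
set J := add_ideal _ _ in Jcl *.
have Jd : J (leavitt_of_free delta).
  exists (leavitt_of_free delta); first exact: left_ideal_refl.
  by exists 0; [case: gcl | rewrite addr0].
have Jg : J (leavitt_of_free gamma).
  exists 0; first by case: dcl.
  by exists (leavitt_of_free gamma); [exact: left_ideal_refl | rewrite add0r].
have [lambda [lambda1 Jl lambdaP]] :=
  lideal_comonic_generator _ _ _ _ Jcl gamma_comonic Jg.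
exists lambda; split; first by [].
(* One inclusion holds because [lambda] lies in [J], the other because both generators are
   polynomials in [J], hence left multiples of [lambda]. *)
apply/seteqP; split; last exact: left_ideal_sub.
have [_ LD LM] := left_ideal_closed (leavitt_of_free lambda).
move=> _ [_ [r _ <-] [_ [s _ <-] <-]].
by apply: LD; apply: LM; apply: lambdaP.
Qed.
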